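(* There exist two conjugate nonempty two-sided shift spaces $X$ and $Y$ (over finite alphabets) with $h_F(X) \neq h_F(Y)$.
   Context: A two-sided shift space over a finite alphabet $A$ is a subset $X \subset A^{\mathbb{Z}}$ which is closed (product topology) and invariant under the left shift $\sigma$, $(\sigma x)(n) = x(n+1)$. Two shift spaces $X, Y$ are conjugate if there is a continuous bijection $\varphi: X \to Y$ with $\varphi\circ\sigma = \sigma\circ\varphi$. The language $L(X)$ is the set of all finite words appearing in points of $X$, and $L_n(X)$ is the set of words of length $n$ in $L(X)$. For $w \in L(X)$, the follower set $F_X(w)$ is the set of all words $u \in L(X)$ such that $wu$ occurs in some point of $X$. Set $F_X(n) = \{F_X(w) : w \in L_n(X)\}$. The follower entropy is $h_F(X) = \limsup_{n\to\infty}\frac{1}{n}\log|F_X(n)|$. *)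

(* Defs.v *)
From HB Require Import structures.
From mathcomp Require Import all_boot all_order all_algebra finmap.
From mathcomp Require Import all_classical all_reals all_analysis.

Set Implicit Arguments.
Unset Strict Implicit.
Unset Printing Implicit Defensive.

Import Order.TTheory GRing.Theory Num.Theory.

Local Open Scope classical_set_scope.
Local Open Scope ring_scope.

Definition full_shift (A : finType) : topologicalType :=
  prod_topology (fun _ : int => discrete_topology A).

Definition shift_map (A : finType) (x : full_shift A) : full_shift A :=
  fun n : int => x (n + 1).

(* Invariance of a two-sided shift space means shift_map(X) = X, as the shift is
   invertible; the mere inclusion of shift_map(X) in X would be weaker. *)
Definition is_shift_space (A : finType) (X : set (full_shift A)) : Prop :=
  closed X /\ @shift_map A @` X = X.

(* phi is a total function of which only the restriction to X matters. Every
   map from X to Y extends to such a function, provided Y is nonempty. *)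
Definition conjugate (A B : finType)
    (X : set (full_shift A)) (Y : set (full_shift B)) : Prop :=
  exists phi : full_shift A -> full_shift B,
    [/\ {within X, continuous phi},
        set_bij X Y phi
      & forall x, X x -> phi (shift_map x) = shift_map (phi x)].

Definition word_at (A : finType) (x : full_shift A) (i : int) (n : nat) :
    seq A :=
  [seq (x (i + k%:Z) : A) | k <- iota 0 n].

Definition language (A : finType) (X : set (full_shift A)) : set (seq A) :=
  [set w | exists x i, X x /\ w = word_at x i (size w)].

Definition language_n (A : finType) (X : set (full_shift A)) (n : nat) :
    set (seq A) :=
  [set w | language X w /\ size w = n].

Definition follower_set (A : finType) (X : set (full_shift A)) (w : seq A) :
    set (seq A) :=
  [set u | language X u /\ language X (w ++ u)].

Definition follower_sets (A : finType) (X : set (full_shift A)) (n : nat) :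
    set (set (seq A)) :=
  follower_set X @` language_n X n.

(* fset_set returns a junk value on infinite sets, so this is needed for the
   cardinality in follower_entropy to be meaningful. *)
Lemma finite_follower_sets (A : finType) (X : set (full_shift A)) (n : nat) :
  finite_set (follower_sets X n).
Proof.
apply: finite_image.
apply: (@sub_finite_set _ _ ((@tval n A) @` [set: n.-tuple A])).
  by move=> w [_ sw]; exists (Tuple (introT eqP sw)).
exact/finite_image/finite_finset.
Qed.

Definition follower_entropy (R : realType) (A : finType)
    (X : set (full_shift A)) : \bar R :=
  limn_esup (fun n : nat =>
    (n%:R^-1 * ln (#|` fset_set (follower_sets X n)|%:R : R))%:E).

(* Main.v *)
(* In Y = implicit_shift a point carries at most one marker. The letter before
   the marker sets a mode, i.e. selects one of the two bits that every letter
   carries, and a query l places after the marker asserts that the bit in that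
   mode of the letter [logn 2 l] places after the marker is 1; each place can
   thus be queried arbitrarily far to the right. X = explicit_shift is Y with
   the mode written on the marker, so the two are conjugate. In X the future of
   a word of length n is restricted by at most one bit sequence, whence at most
   4(n+1)2^n follower sets. A word of Y starting with the marker does not
   determine the mode: its follower set is a union over both modes and remembers
   both bit sequences, whence at least 4^(n-2) follower sets. *)
Require Import Defs.
From mathcomp Require Import all_boot all_order all_algebra finmap.
From mathcomp Require Import all_classical all_reals all_analysis.
From mathcomp Require Import zify lra.

Set Implicit Arguments.
Unset Strict Implicit.
Unset Printing Implicit Defensive.

Import Order.TTheory GRing.Theory Num.Theory.

Local Open Scope classical_set_scope.
Local Open Scope ring_scope.

(** * Cylinders, closedness and continuity in the full shift *)

Lemma nbhs_cylinder (A : finType) (x : full_shift A) (s : seq int) :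
  nbhs x [set y : full_shift A | forall i, i \in s -> y i = x i].
Proof.
elim: s => [|i s IHs]; first by apply: filterS filterT.
have nxi : nbhs x (proj i @^-1` [set x i] : set (full_shift A)).
  apply: (@proj_continuous _ _ i x); exact: discrete_set1.
apply: filterS (filterI nxi IHs) => y [yi ys] j.
by rewrite inE => /predU1P[->|/ys].
Qed.

Lemma closed_cylinder (A : finType) (X : set (full_shift A)) :
  (forall x, ~ X x -> exists s : seq int,
     forall y : full_shift A, (forall i, i \in s -> y i = x i) -> ~ X y) ->
  closed X.
Proof.
move=> locX; rewrite -(setCK X) closedC openE => x /locX[s sX].
exact: filterS (nbhs_cylinder x s).
Qed.

Lemma cvg_cylinder (A : finType) (F : set_system (full_shift A))
    (x : full_shift A) : Filter F ->
  (forall i, F [set y : full_shift A | y i = x i]) -> F --> x.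
Proof.
move=> FF Fx; apply/cvg_sup => i; apply/cvg_image.
  (* Constant points show that each projection is onto. *)
  by rewrite eqEsubset; split=> // b _; exists (fun=> b).
move=> U /principal_filterP Uxi.
exists (proj i @^-1` U); last first.
  by rewrite image_preimage// eqEsubset; split=> // b _; exists (fun=> b).
by apply: filterS (Fx i) => y /= yi; rewrite /proj yi.
Qed.

Definition letterwise (A B : finType) (f : A -> B) (x : full_shift A) :
  full_shift B := fun i => f (x i).

Lemma letterwise_continuous (A B : finType) (f : A -> B) :
  continuous (letterwise f).
Proof.
move=> x.
have FF : Filter (fmap (letterwise f) (nbhs x)).
  exact: (@fmap_filter _ _ (letterwise f) _ (@nbhs_filter (full_shift A) x)).
apply: (@cvg_cylinder B _ (letterwise f x) FF) => i.
apply: (@filterS _ _ (@nbhs_filter (full_shift A) x) _ _ _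
  (nbhs_cylinder x [:: i])).
move=> y /= /(_ i (mem_head _ _)).
by rewrite /letterwise => ->.
Qed.

(** * Words and follower sets of translation-invariant sets *)

Section Translation.
Variables (A : finType) (X : set (full_shift A)).

Definition translate (d : int) (x : full_shift A) : full_shift A :=
  fun i => x (i + d).

Hypothesis translateX : forall d x, X x -> X (translate d x).

Lemma translation_invariant_shift : @shift_map A @` X = X.
Proof.
apply/seteqP; split=> [_ [x Xx <-]|x Xx]; first exact: (translateX 1).
exists (translate (-1) x); first exact: translateX.
by apply/funext => i; rewrite /shift_map /translate addrK.
Qed.

Lemma size_word_at (x : full_shift A) i n : size (word_at x i n) = n.
Proof. by rewrite size_map size_iota. Qed.

Lemma nth_word_at (a : A) (x : full_shift A) i n k : (k < n)%N ->
  nth a (word_at x i n) k = x (i + k%:Z).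
Proof. by move=> kn; rewrite (nth_map 0%N) ?size_iota// nth_iota. Qed.

(** Translation invariance lets every occurrence of a word be moved to the origin. *)
Lemma languageP (a : A) (w : seq A) : language X w <->
  exists2 x, X x & forall k, (k < size w)%N -> x k%:Z = nth a w k.
Proof.
split=> [[x [i [Xx wE]]]|[x Xx wE]].
  exists (translate i x) => [|k kw]; first exact: translateX.
  by rewrite wE nth_word_at// addrC.
exists x, 0; split=> //.
apply: (@eq_from_nth _ a) => [|k kw]; first by rewrite size_word_at.
by rewrite nth_word_at// add0r wE.
Qed.

Lemma follower_setP (w u : seq A) :
  follower_set X w u <-> language X (w ++ u).
Proof.
split=> [[]//|Lwu]; split=> //.
case: Lwu => x [i [Xx wuE]]; exists x, (i + (size w)%:Z); split=> //.
have := congr1 (drop (size w)) wuE; rewrite drop_size_cat// => {1}->.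
rewrite size_cat /word_at -map_drop drop_iota add0n addKn.
rewrite -[X in iota X _]addn0 iotaDl -map_comp; apply: eq_map => k /=.
by rewrite PoszD addrA.
Qed.

End Translation.

(** * Counting follower sets by codes and by families of words *)

Section Cardinality.
Variables (A : finType) (X : set (full_shift A)) (n : nat).

Lemma card_follower_sets_le (C : finType) (code : seq A -> C) :
  (forall w w', language_n X n w -> language_n X n w' -> code w = code w' ->
     follower_set X w `<=` follower_set X w') ->
  (#|` fset_set (follower_sets X n)| <= #|C|)%N.
Proof.
move=> codeP.
(* [F c] is the follower set of a chosen word with code [c]; the default [[::]] occurs only for
   codes of no word. *)
pose F c := follower_set X (xget [::] [set w | language_n X n w /\ code w = c]).
have subF : follower_sets X n `<=` F @` [set: C].
  move=> _ [w Lw <-]; exists (code w) => //; rewrite /F.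
  case: xgetP => [v _ [Lv vw]|/(_ w)[]//].
  by apply/seteqP; split; apply: codeP.
have finF : finite_set (F @` [set: C]).
  by apply: finite_image; exact: finite_finset.
move: subF; rewrite fset_set_sub//; last exact: finite_follower_sets.
move=> /fsubset_leq_card/leq_trans; apply.
rewrite fset_set_image; last exact: finite_finset.
apply: (leq_trans (leq_imfset_card _ _ _)).
by rewrite -(card_uniqP (fset_uniq _)) max_card.
Qed.

Lemma card_follower_sets_ge (C : finType) (w : C -> seq A) :
  (forall c, language_n X n (w c)) ->
  (forall c d, follower_set X (w c) = follower_set X (w d) -> c = d) ->
  (#|C| <= #|` fset_set (follower_sets X n)|)%N.
Proof.
move=> Lw winj.
have : (follower_set X \o w) @` [set: C] `<=` follower_sets X n.
  by move=> _ [c _ <-]; exists (w c).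
rewrite fset_set_sub//; last exact: finite_follower_sets.
  move=> /fsubset_leq_card; apply: leq_trans.
  rewrite fset_set_image; last exact: finite_finset.
  rewrite card_imfset; last exact: winj.
  rewrite cardE uniq_leq_size ?enum_uniq// => c _.
  by rewrite in_fset_set ?inE//; exact: finite_finset.
by apply: finite_image; exact: finite_finset.
Qed.

End Cardinality.

(** * Bounds on the limit superior from bounds on a tail *)

Section Limsup.
Variables (R : realType) (u : (\bar R)^nat) (N : nat).

Lemma limn_esup_le c : (forall n, (N <= n)%N -> u n <= c)%E ->
  (limn_esup u <= c)%E.
Proof.
move=> uc; apply: (@le_trans _ _ (ereal_sup (u @` [set n | (N <= n)%N]))).
  apply: ereal_inf_lbound; exists [set n | (N <= n)%N] => //.
  by exists N.
by apply: ge_ereal_sup => _ [n /uc un <-].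
Qed.

Lemma limn_esup_ge c : (forall n, (N <= n)%N -> c <= u n)%E ->
  (c <= limn_esup u)%E.
Proof.
move=> cu; apply: le_ereal_inf_tmp => _ [V [M _ MV] <-].
apply: (le_trans (cu _ (leq_maxl N M))); apply: ereal_sup_ubound.
by exists (maxn N M) => //; apply: MV; exact: leq_maxr.
Qed.

End Limsup.

(** * The two shift spaces and their conjugacy *)

Definition letter : finType := ((bool * bool) * (bool * bool))%type.

Definition is_marker (a : letter) : bool := a.1.1.
Definition is_query (a : letter) : bool := a.1.2.
Definition bit (m : bool) (a : letter) : bool := if m then a.2.1 else a.2.2.

(** A query never looks to its right, as [logn 2 l <= l]. Since [logn 2 0 = 0], a query on the
    marker looks at the marker itself. *)
Definition implicit_shift : set (full_shift letter) :=
  [set y | (forall i j, is_marker (y i) -> is_marker (y j) -> i = j) /\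
    (forall i (l : nat), is_marker (y i) -> is_query (y (i + l%:Z)) ->
       bit (bit true (y (i - 1))) (y (i + (logn 2 l)%:Z)))].

Definition explicit_shift : set (full_shift (letter * bool)%type) :=
  [set x | implicit_shift (letterwise fst x) /\
    forall i, (x i).2 = is_marker (x i).1 && bit true (x (i - 1)).1].

Lemma implicit_translate d y :
  implicit_shift y -> implicit_shift (translate d y).
Proof.
rewrite /translate => -[y1 yq]; split=> [i j yi yj|i l yi].
  by apply: (addIr d); apply: y1.
by rewrite ![_ + _ + d]addrAC; apply: yq.
Qed.

Lemma explicit_translate d x :
  explicit_shift x -> explicit_shift (translate d x).
Proof.
move=> [xY x2]; split; first exact: (implicit_translate d xY).
by move=> i; rewrite /translate x2 addrAC.
Qed.

Lemma implicit_closed : closed implicit_shift.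
Proof.
apply: closed_cylinder => y nYy.
have [y1|/existsNP[i /existsNP[j nij]]] :=
    pselect (forall i j, is_marker (y i) -> is_marker (y j) -> i = j).
  have [yq|/existsNP[i /existsNP[l nil]]] :=
      pselect (forall i (l : nat), is_marker (y i) -> is_query (y (i + l%:Z)) ->
       bit (bit true (y (i - 1))) (y (i + (logn 2 l)%:Z))).
    by exfalso; apply: nYy.
  exists [:: i; i + l%:Z; i - 1; i + (logn 2 l)%:Z] => y' yy' [_ /(_ i l)].
  by rewrite !yy' ?inE ?eqxx ?orbT.
exists [:: i; j] => y' yy' [/(_ i j) + _].
by rewrite !yy' ?inE ?eqxx ?orbT.
Qed.

Lemma explicit_closed : closed explicit_shift.
Proof.
rewrite /explicit_shift (_ : mkset _ = letterwise fst @^-1` implicit_shift `&`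
  [set x : full_shift (letter * bool)%type |
    forall i, (x i).2 = is_marker (x i).1 && bit true (x (i - 1)).1]) //.
apply: closedI.
  apply: closed_comp implicit_closed => x _; exact: letterwise_continuous.
apply: closed_cylinder => x /existsNP[i nx].
by exists [:: i; i - 1] => x' xx' /(_ i); rewrite !xx' ?inE ?eqxx ?orbT.
Qed.

(** Erasing the second component loses nothing: it is prescribed by the present letter and the one
    before it. *)
Lemma explicit_implicit_conjugate : conjugate explicit_shift implicit_shift.
Proof.
exists (letterwise fst); split=> //.
  exact/continuous_subspaceT/letterwise_continuous.
split=> [x []//|x x' /set_mem[_ x2] /set_mem[_ x'2] xx'|y Yy].
  have fstE i : (x i).1 = (x' i).1 by have := congr1 (@^~ i) xx'.
  by apply/funext => i; rewrite [x i]surjective_pairing [x' i]surjective_pairing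
    x2 x'2 !fstE.
pose x : full_shift (letter * bool)%type :=
  fun i => (y i : letter, is_marker (y i) && bit true (y (i - 1))).
by exists x.
Qed.

Lemma implicit_nonempty : implicit_shift !=set0.
Proof. by exists (fun=> (false, false, (false, false))); split. Qed.

Lemma explicit_nonempty : explicit_shift !=set0.
Proof. by exists (fun=> (false, false, (false, false), false)); split. Qed.

(** * Upper bound on the follower sets of the explicit shift *)

(* At a marker the second component is the mode, so queries can be phrased
   without reference to the letter before the marker. *)
Lemma explicit_query x i (l : nat) : explicit_shift x ->
  is_marker (x i).1 -> is_query (x (i + l%:Z)).1 ->
  bit (x i).2 (x (i + (logn 2 l)%:Z)).1.
Proof. by move=> [[_ xq] x2] xi; rewrite x2 xi; apply: xq. Qed.

(* The left part of the splice carries no marker, so it imposes nothing on the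
   right part; its constant letter shows the mode of a possible marker at 0. *)
Lemma explicit_splice n x z :
  (0 < n)%N -> explicit_shift x -> explicit_shift z ->
  bit true (x n.-1%:Z).1 = bit true (z n.-1%:Z).1 ->
  (forall k : nat, (k < n)%N -> is_marker (z k%:Z).1 ->
     [/\ is_marker (x k%:Z).1, (x k%:Z).2 = (z k%:Z).2
       & forall l : nat, (l < n)%N ->
           bit (z k%:Z).2 (x l%:Z).1 = bit (z k%:Z).2 (z l%:Z).1]) ->
  exists2 y, explicit_shift y &
    forall k : nat, y k%:Z = if (k < n)%N then z k%:Z else x k%:Z.
Proof.
move=> n0 Xx Xz lastxz markxz.
pose y : full_shift (letter * bool)%type := fun i =>
  match i with
  | Posz k => if (k < n)%N then z k%:Z else x k%:Z
  | Negz _ => (false, false, ((z 0).2, false), false)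
  end.
have [[x1 _] x2] := Xx; have [[z1 _] z2] := Xz.
have yE (k : nat) : y k%:Z = if (k < n)%N then z k%:Z else x k%:Z by [].
have y2 i : (y i).2 = is_marker (y i).1 && bit true (y (i - 1)).1.
  case: i => [[|k]|k] //.
    by rewrite yE n0; have := z2 0; case: (is_marker _) => //=.
  have kE : k.+1%:Z - 1 = k%:Z by lia.
  rewrite kE !yE; have [_|_|kn] := ltngtP k.+1 n.
  - by rewrite z2 kE.
  - by rewrite x2 kE.
  (* At the seam the preceding letter comes from [z]; [lastxz] gives it the same mode bit as the
     letter of [x]. *)
  - by rewrite x2 kE -[k]/k.+1.-1 kn lastxz.
exists y => //; split; [split|exact: y2].
- move=> [i|i] [j|j]; rewrite /letterwise//=.
  case: ifP => im; case: ifP => jm; first exact: z1.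
  + move=> /(markxz _ im)[xi _ _] xj; exact: x1.
  + move=> xi /(markxz _ jm)[xj _ _]; exact: x1.
  + exact: x1.
- suff yq (i l : nat) : is_marker (y i%:Z).1 -> is_query (y (i + l)%:Z).1 ->
      bit (y i%:Z).2 (y (i + logn 2 l)%:Z).1.
    move=> [i|//] l; rewrite /letterwise => yi yil.
    by have := yq i l yi yil; rewrite y2 yi.
  have gl : (logn 2 l <= l)%N.
    by case: (posnP l) => [->|/(ltn_logl 2)/ltnW]; rewrite ?logn0.
  rewrite !yE; case: ifP => im; last first.
    have -> : (i + l < n)%N = false by lia.
    have -> : (i + logn 2 l < n)%N = false by lia.
    by rewrite !PoszD; exact: explicit_query.
  case: ifP => iln zi.
    have -> : (i + logn 2 l < n)%N by lia.
    by rewrite !PoszD; exact: explicit_query.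
  (* The marker comes from [z] and the query from [x]. As [x] has the same marker and mode, it
     satisfies the query; if the queried place lies left of the seam, the bits of [x] and [z] agree
     there. *)
  have [xi xzi xz] := markxz _ im zi.
  rewrite -xzi PoszD => xq; have := explicit_query Xx xi xq.
  rewrite -PoszD; case: ifP => // iln'.
  by rewrite xzi xz.
Qed.

(** All that a word can impose on its future: the marker position ([n] if a word of length [n] has
    none), the mode, the bits in that mode, and the last letter's bit, which is the mode of a marker
    coming right after the word. *)
Definition follower_code n (w : seq (letter * bool)) :
    'I_n.+1 * (bool * bool) * {ffun 'I_n -> bool} :=
  let a := ((false, false, (false, false)), false) in
  let p := find (is_marker \o fst) w in
  (inord p, ((nth a w p).2, bit true (last a w).1),
   [ffun l : 'I_n => bit (nth a w p).2 (nth a w l).1]).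

(** A point [x] showing [w ++ u] is spliced with a point [z] showing [w']; equality of the codes is
    what the splice requires. *)
Lemma follower_code_sub n w w' :
  language_n explicit_shift n w -> language_n explicit_shift n w' ->
  follower_code n w = follower_code n w' ->
  follower_set explicit_shift w `<=` follower_set explicit_shift w'.
Proof.
set a : letter * bool := ((false, false, (false, false)), false).
have LP := languageP explicit_translate a.
have [->|n0] := posnP n; first by move=> [_ /size0nil->] [_ /size0nil->] _ u.
move=> [_ sw] [/LP[z Xz zw'] sw'] [/(congr1 val)].
rewrite /= !inordK; last 2 first.
- by rewrite -sw' ltnS find_size.
- by rewrite -sw ltnS find_size.
set p := find _ w => pE; rewrite -/a -pE => mE lE /ffunP bE u.
move=> /follower_setP/LP[x Xx xwu].
apply/follower_setP/LP.
have xw (k : nat) : (k < n)%N -> x k%:Z = nth a w k.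
  by move=> kn; rewrite xwu ?nth_cat ?size_cat ?sw ?kn// ltn_addr.
have {}zw' (k : nat) : (k < n)%N -> z k%:Z = nth a w' k.
  by move=> kn; rewrite zw' ?sw'.
have [|k kn zk|y Xy yE] := @explicit_splice n x z n0 Xx Xz.
- by rewrite xw ?zw' ?ltn_predL//; move: lE; rewrite -!nth_last sw sw'.
(* A marker of [z] inside the word must be the one at [p], the position recorded by both codes. *)
- have hw' : has (is_marker \o fst) w'.
    by apply/(has_nthP a); exists k; rewrite ?sw' //= -zw'.
  have pn : (p < n)%N by rewrite pE -sw' -has_find.
  have zp : is_marker (z p%:Z).1 by rewrite zw'// pE; exact: (nth_find a hw').
  have [[z1 _] _] := Xz; have [kp] := z1 _ _ zk zp; rewrite kp.
  have hw : has (is_marker \o fst) w by rewrite has_find sw.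
  split=> [||l ln]; rewrite !xw// ?zw' //; first exact: (nth_find a hw).
  by have := bE (Ordinal ln); rewrite !ffunE /= -mE.
exists y => // k; rewrite size_cat sw' => kn; rewrite yE nth_cat sw'.
case: ifP => [/zw'//|nk]; rewrite xwu ?size_cat ?sw//.
by rewrite nth_cat sw nk.
Qed.

Lemma card_explicit_follower_sets n :
  (#|` fset_set (follower_sets explicit_shift n)| <= n.+1 * 4 * 2 ^ n)%N.
Proof.
apply: leq_trans (card_follower_sets_le (@follower_code_sub n)) _.
by rewrite !card_prod card_ffun !card_bool !card_ord.
Qed.

(** * Lower bound on the follower sets of the implicit shift *)

Section FreeWords.
Variable n : nat.
Implicit Types (f g : {ffun 'I_n -> bool * bool}) (m : bool).

(* The first two letters make the bit sequences of the two modes incomparable,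
   so that a follower set tells which sequence belongs to which mode. *)
Definition free_letter f (k : nat) : letter :=
  match k with
  | 0 => (true, false, (true, false))
  | 1 => (false, false, (false, true))
  | k.+2 => (false, false, oapp f (false, false) (insub k))
  end.

Definition free_word f : seq letter := mkseq (free_letter f) n.+2.

(** Right of the word, queries stand at all places where mode [m] allows them, so this future
    reveals the bits of [f] in mode [m]. The constant left part sets the mode to [m]. *)
Definition free_point f m : full_shift letter := fun i =>
  match i with
  | Posz l => if (l < n.+2)%N then free_letter f l
              else (false, bit m (free_letter f (logn 2 l)), (false, false))
  | Negz _ => (false, false, (m, false))
  end.

Lemma bit_free_letter_lt f m k : bit m (free_letter f k) -> (k < n.+2)%N.
Proof.
case: k => [|[|k]] //; rewrite /free_letter; case: insubP => [i|_] //=.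
by case: m.
Qed.

Lemma free_point_implicit f m : implicit_shift (free_point f m).
Proof.
have mark0 i : is_marker (free_point f m i) -> i = 0.
  by case: i => [[|[|k]]|k] //=; case: ifP.
split=> [i j /mark0-> /mark0->//|i l /mark0->]; rewrite !add0r.
rewrite [free_point f m l%:Z]/=; case: ifP => [_|_ /= ml].
  by case: l => [|[]].
by rewrite (bit_free_letter_lt ml).
Qed.

Lemma free_word_language f : language_n implicit_shift n.+2 (free_word f).
Proof.
split; last exact: size_mkseq.
apply/(languageP implicit_translate (free_letter f 0)).
exists (free_point f true); first exact: free_point_implicit.
by rewrite size_mkseq => k kn; rewrite nth_mkseq//= kn.
Qed.

(** The future of [free_point f m] queries every true bit of [f] in mode [m]. If it can follow
    [free_word g], those bits are true for [g] in some mode, and the first two letters force that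
    mode to be [m]. *)
Lemma free_word_follower_sub f g m k :
  follower_set implicit_shift (free_word f) `<=`
    follower_set implicit_shift (free_word g) ->
  bit m (free_letter f k) -> bit m (free_letter g k).
Proof.
pose a := free_letter f 0; have LP := languageP implicit_translate a.
(* An odd number exceeding [n.+2]: for [j < n.+2], the place [2 ^ j * odd_part] lies right of the
   word, within reach of [u], and queries exactly place [j]. *)
pose odd_part := (2 ^ n.+2).+1.
pose u := mkseq (fun j : nat => free_point f m (n.+2 + j)%N%:Z)
  (2 ^ n.+2 * odd_part)%N.
move=> /(_ u)[].
  apply/follower_setP/LP; exists (free_point f m).
    exact: free_point_implicit.
  move=> j; rewrite size_cat nth_cat !size_mkseq => jn.
  case: ltnP => nj; first by rewrite nth_mkseq//= nj.
  by rewrite nth_mkseq ?subnKC// ltn_subLR.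
move=> _ /LP[y [y1 yq] yE].
have y0 (j : nat) : (j < n.+2)%N -> y j%:Z = free_letter g j.
  move=> jn; rewrite yE ?size_cat ?size_mkseq ?ltn_addr// nth_cat size_mkseq jn.
  by rewrite nth_mkseq.
have ysub j : bit m (free_letter f j) ->
    bit (bit true (y (0 - 1))) (free_letter g j).
  move=> fj; have jn := bit_free_letter_lt fj.
  pose l := (2 ^ j * odd_part)%N.
  have lj : logn 2 l = j.
    rewrite lognM ?expn_gt0// pfactorK// logn_coprime ?addn0//.
    by rewrite coprime2n /odd_part /= oddX.
  have nl : (n.+2 <= l)%N.
    rewrite (leq_trans (ltnW (ltn_expl n.+2 (ltnSn 1))))//.
    by rewrite (leq_trans (leqnSn _))// leq_pmull ?expn_gt0.
  have lN : (l < 2 ^ n.+2 * odd_part)%N by rewrite ltn_pmul2r// ltn_exp2l.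
  have := yq 0 l; rewrite !add0r lj (y0 0%N)// (y0 j)//; apply=> //.
  rewrite yE ?size_cat ?size_mkseq ?ltn_addl// nth_cat size_mkseq ltnNge nl /=.
  rewrite nth_mkseq ?(leq_ltn_trans (leq_subr _ _))// subnKC//=.
  by rewrite ltnNge nl /= lj.
suff ym : bit true (y (0 - 1)) = m by move: (ysub k); rewrite ym.
(* Letter 0 has only its bit in mode [true] set and letter 1 only its bit in mode [false], so
   neither mismatch of modes is possible. *)
move: {+}m (bit true _) ysub => [] [] // ysub; first by have := ysub 0%N isT.
by have := ysub 1%N isT.
Qed.

Lemma card_implicit_follower_sets :
  (4 ^ n <= #|` fset_set (follower_sets implicit_shift n.+2)|)%N.
Proof.
have -> : (4 ^ n = #|{ffun 'I_n -> bool * bool}|)%N.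
  by rewrite card_ffun card_prod card_bool card_ord.
apply: (card_follower_sets_ge free_word_language) => f g fg.
apply/ffunP => i.
have bitE m : bit m (free_letter f i.+2) = bit m (free_letter g i.+2).
  by apply/idP/idP; apply: free_word_follower_sub; rewrite fg.
have := (bitE true, bitE false); rewrite /= !valK /= => -[].
by case: (f i) (g i) => [? ?] [? ?] /= -> ->.
Qed.

End FreeWords.

(** * From cardinalities to entropies, and the conclusion *)

Section EntropyBounds.
Variables (R : realType) (A : finType) (X : set (full_shift A)).
Variables (N : nat) (b : R).
Hypothesis b1 : 1 < b.
Let card n := #|` fset_set (follower_sets X n)|.

Lemma follower_entropy_le :
  (forall n, (N <= n)%N -> (card n)%:R <= b ^+ n) ->
  (follower_entropy R X <= (ln b)%:E)%E.
Proof.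
move=> cb; apply: (@limn_esup_le _ _ N.+1) => n Nn; rewrite lee_fin.
rewrite -/(card n) ler_pdivrMl ?ltr0n; last exact: leq_ltn_trans Nn.
rewrite mulr_natl -lnXn ?(lt_trans ltr01)//.
(* Without follower sets the convention [ln 0 = 0] applies. *)
have [->|c0] := posnP (card n).
  by rewrite ln0// ln_ge0// exprn_ege1// ltW.
by rewrite ler_ln ?posrE ?ltr0n ?exprn_gt0 ?(lt_trans ltr01)// cb// ltnW.
Qed.

Lemma follower_entropy_ge :
  (forall n, (N <= n)%N -> b ^+ n <= (card n)%:R) ->
  ((ln b)%:E <= follower_entropy R X)%E.
Proof.
move=> bc; apply: (@limn_esup_ge _ _ N.+1) => n Nn; rewrite lee_fin.
have bn : 0 < b ^+ n by rewrite exprn_gt0// (lt_trans ltr01).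
rewrite -/(card n) ler_pdivlMl ?ltr0n; last exact: leq_ltn_trans Nn.
rewrite mulr_natl -lnXn ?(lt_trans ltr01)//.
have {}bc := bc n (ltnW Nn).
by rewrite ler_ln ?posrE ?(lt_le_trans bn bc).
Qed.

End EntropyBounds.

(** Any base above 2 eventually dominates; for base 3 the bound holds from [n = 10] on. *)
Lemma explicit_entropy (R : realType) :
  (follower_entropy R explicit_shift <= (ln 3)%:E)%E.
Proof.
apply: (@follower_entropy_le _ _ _ 10) => [|n]; first by rewrite ltr1n.
move=> /subnKC <-; move: (n - 10)%N => {}n.
apply: (@le_trans _ _ ((10 + n).+1 * 4 * 2 ^ (10 + n))%:R).
  by rewrite ler_nat card_explicit_follower_sets.
rewrite natrM natrX natrM -natr1 natrD; elim: n => [|n IHn].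
  by rewrite addn0 !exprS expr0; lra.
rewrite addnS (exprS 2 (10 + n)) (exprS 3 (10 + n)) -[n.+1%:R]natr1.
have : 0 <= n%:R * 2 ^+ (10 + n) :> R by rewrite mulr_ge0 ?exprn_ge0.
have : 0 <= 2 ^+ (10 + n) :> R by rewrite exprn_ge0.
by move: IHn; lra.
Qed.

(** A base below 4 absorbs the two fixed letters; [7 / 2] exceeds 3, and 21 is the first [n] with
    [(7 / 2) ^ n <= 4 ^ (n - 2)]. *)
Lemma implicit_entropy (R : realType) :
  ((ln (7 / 2))%:E <= follower_entropy R implicit_shift)%E.
Proof.
apply: (@follower_entropy_ge _ _ _ 21) => [|n]; first by lra.
move=> /subnKC <-; move: (n - 21)%N => {}n.
apply: (@le_trans _ _ (4 ^ (19 + n))%:R); last first.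
  by rewrite ler_nat card_implicit_follower_sets.
rewrite natrX; elim: n => [|n IHn].
  by rewrite !addn0 !exprS expr0; lra.
rewrite !addnS (exprS _ (21 + n)) (exprS 4 (19 + n)).
have : 0 <= 4 ^+ (19 + n) :> R by rewrite exprn_ge0.
by move: IHn; lra.
Qed.

Theorem theorem3p6 (R : realType) :
  exists (A B : finType) (X : set (full_shift A)) (Y : set (full_shift B)),
    [/\ is_shift_space X /\ X !=set0,
        is_shift_space Y /\ Y !=set0,
        conjugate X Y
      & follower_entropy R X <> follower_entropy R Y].
Proof.
exists _, _, explicit_shift, implicit_shift; split.
- split; [split|exact: explicit_nonempty]; first exact: explicit_closed.
  exact/translation_invariant_shift/explicit_translate.
- split; [split|exact: implicit_nonempty]; first exact: implicit_closed.
  exact/translation_invariant_shift/implicit_translate.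
- exact: explicit_implicit_conjugate.
- move=> XY; have := explicit_entropy R.
  rewrite XY => /(le_trans (implicit_entropy R)).
  by rewrite lee_fin ler_ln ?posrE; lra.
Qed.
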